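(* Every $(P_7,C_7,C_4,\text{gem})$-free graph $G$ (with at least one vertex) satisfies $\chi(G)\leq 2\omega(G)-1$.
   Context: All graphs are finite and simple. $P_\ell$ and $C_\ell$ denote the chordless path and chordless cycle on $\ell$ vertices. The gem is the graph consisting of a $P_4$ together with a vertex adjacent to all four vertices of the $P_4$. A graph is $(L_1,L_2,\ldots)$-free if it has no induced subgraph isomorphic to any $L_i$. $\chi(G)$ is the chromatic number and $\omega(G)$ the size of a largest clique of $G$. *)

(* Defs.v *)
From mathcomp Require Import all_boot.

Set Implicit Arguments.
Unset Strict Implicit.
Unset Printing Implicit Defensive.

Record sgraph := SGraph {
  vertex :> finType;
  adj : rel vertex;
  adj_sym : symmetric adj;
  adj_irr : irreflexive adj }.

Definition path_rel (n : nat) : rel 'I_n :=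
  fun i j => (j == i.+1 :> nat) || (i == j.+1 :> nat).

Lemma path_rel_sym n : symmetric (@path_rel n).
Proof. by move=> i j; rewrite /path_rel orbC. Qed.

Lemma path_rel_irr n : irreflexive (@path_rel n).
Proof. by move=> i; rewrite /path_rel orbb; apply/negbTE; rewrite neq_ltn leqnn. Qed.

Definition path_graph (n : nat) : sgraph :=
  SGraph (@path_rel_sym n) (@path_rel_irr n).

(* The conjunct [i != j] only matters for n = 1, where it removes a loop. *)
Definition cycle_rel (n : nat) : rel 'I_n :=
  fun i j => (i != j) && ((j == i.+1 %% n :> nat) || (i == j.+1 %% n :> nat)).

Lemma cycle_rel_sym n : symmetric (@cycle_rel n).
Proof. by move=> i j; rewrite /cycle_rel eq_sym orbC. Qed.

Lemma cycle_rel_irr n : irreflexive (@cycle_rel n).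
Proof. by move=> i; rewrite /cycle_rel eqxx. Qed.

Definition cycle_graph (n : nat) : sgraph :=
  SGraph (@cycle_rel_sym n) (@cycle_rel_irr n).

(* [Some i] are the vertices of P_4, [None] is the dominating vertex. *)
Definition gem_rel : rel (option 'I_4) :=
  fun u v => match u, v with
             | Some i, Some j => path_rel i j
             | None, None => false
             | _, _ => true
             end.

Lemma gem_rel_sym : symmetric gem_rel.
Proof. by case=> [i|] [j|] //=; apply: path_rel_sym. Qed.

Lemma gem_rel_irr : irreflexive gem_rel.
Proof. by case=> [i|] //=; apply: path_rel_irr. Qed.

Definition gem : sgraph := SGraph gem_rel_sym gem_rel_irr.

Definition induced_subgraph (L G : sgraph) : Prop :=
  exists f : L -> G, injective f /\ forall x y, adj (f x) (f y) = adj x y.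

Definition free_of (L G : sgraph) : Prop := ~ induced_subgraph L G.

Definition clique (G : sgraph) (A : {set G}) : bool :=
  [forall x in A, forall y in A, (x != y) ==> adj x y].

Definition omega (G : sgraph) : nat := \max_(A : {set G} | clique A) #|A|.

Definition colorable (G : sgraph) (k : nat) : bool :=
  [exists c : {ffun G -> 'I_k}, forall x, forall y, adj x y ==> (c x != c y)].

Lemma ex_colorable (G : sgraph) : exists k, colorable G k.
Proof.
exists #|G|; apply/existsP; exists [ffun x => enum_rank x].
apply/forallP=> x; apply/forallP=> y; apply/implyP=> xy.
by rewrite !ffunE (inj_eq enum_rank_inj); apply: contraTneq xy => ->; rewrite adj_irr.
Qed.

Definition chi (G : sgraph) : nat := ex_minn (ex_colorable G).

(* Main.v *)
(* Let K be a maximal clique.  Two adjacent vertices of N(K) have the same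
   neighbours in K (otherwise there is a C4 or a gem), so N(K) is chordal and
   its cliques extend by a vertex of K: it can be coloured with omega - 1
   colours.  If moreover the set of vertices far from K contains no C5 and no
   C6, then that set is chordal, and together with K it takes omega further
   colours.

   A good K is found by descent.  Let Q be a component of the far part that
   contains a hole C.  By P7-freeness every vertex of N(Q) has a neighbour on
   C.  If C is a C5, it is a twin of a vertex of C, and two consecutive
   vertices of C are never both cloned, so some vertex of C is complete to
   N(Q).  If C is a C6, it sees two opposite vertices of C, and C7-freeness
   makes the neighbourhoods in K a chain, so some vertex of K is complete to
   N(Q).  In either case take a maximal clique K' containing this vertex z and
   some a in N(Q).  A component Q' of the far part of K' containing a hole
   misses N(Q) and the neighbours of a; if it were not inside Q, then induced
   P4's into Q and into Q' would combine to a P7.  Hence |Q'| < |Q|. *)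

Require Import Defs.
From mathcomp Require Import all_boot.

Set Implicit Arguments.
Unset Strict Implicit.
Unset Printing Implicit Defensive.

Local Notation "x -- y" := (adj x y) (at level 30, no associativity).

(* Distinctness is not imposed: it follows from the adjacencies as soon as
   there are at least four vertices. *)
Fixpoint ipath (G : sgraph) (s : seq G) : bool :=
  if s is x :: t then
    (if t is y :: t' then (x -- y) && all (fun z => ~~ (x -- z)) t' else true)
    && ipath t
  else true.
Arguments ipath : simpl never.

(** * Induced paths *)

Section InducedPaths.

Variable G : sgraph.
Implicit Types (x y u : G) (s p : seq G).

Lemma ipath_cons x t :
  ipath (x :: t) =
  (if t is y :: t' then (x -- y) && all (fun z => ~~ (x -- z)) t' else true)
    && ipath t.
Proof. by []. Qed.

Lemma ipath_cat_l s t : ipath (s ++ t) -> ipath s.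
Proof.
elim: s => //= x s IHs; rewrite !ipath_cons => /andP[xs /IHs ->].
rewrite andbT.
by case: s xs {IHs} => //= y s; rewrite all_cat => /andP[-> /andP[->]].
Qed.

Lemma ipath_cons2 x y s :
  x -- y -> {in s, forall z, ~~ (x -- z)} -> ipath (y :: s) ->
  ipath [:: x, y & s].
Proof. by move=> xy /allP xs ys; rewrite ipath_cons ys andbT xy. Qed.

Lemma ipath_cat_last p a q :
  ipath (rcons p a) -> ipath (a :: q) ->
  {in p & q, forall y z, ~~ (y -- z)} -> ipath (rcons p a ++ q).
Proof.
elim: p => //= x p IHp; rewrite !ipath_cons => /andP[xp pp] aq pq.
rewrite IHp //; last by move=> y z yp; apply: pq; rewrite in_cons yp orbT.
have xq : all (fun z => ~~ (x -- z)) q.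
  by apply/allP => z; apply: pq; rewrite mem_head.
case: p xp {IHp pq pp} => [|y p] /=; first by case/andP=> ->; rewrite xq.
by case/andP=> -> xp; rewrite all_cat xp xq.
Qed.

(** The suffix [q] begins at the last neighbour of [x] on [p], so [x] sees only its head. *)
Lemma ipath_extend x p : ipath p -> has (fun y => x -- y) p ->
  exists p1 q, [/\ p = p1 ++ q, q != [::] & ipath (x :: q)].
Proof.
elim: p => //= h t IHt; rewrite ipath_cons => /andP[ht tt].
case xt : (has _ t); last first.
  rewrite orbF => xh; exists [::], (h :: t); split=> //.
  apply: ipath_cons2 => //; last by rewrite ipath_cons ht tt.
  by move=> z zt; apply/negP => xz; move/negP: xt; apply; apply/hasP; exists z.
by move=> _; have [p1 [q [-> q0 xq]]] := IHt tt xt; exists (h :: p1), q.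
Qed.

(* The walk is cut at its first vertex satisfying P and then shortened. *)
Lemma walk_ipath (P : pred G) x s :
    path (@adj G) x s -> ~~ P x -> has P s ->
  exists p a, [/\ ipath (x :: rcons p a), P a, {in p, forall z, ~~ P z}
    & {subset rcons p a <= s}].
Proof.
elim: s x => //= y s IHs x /andP[xy ys] nPx.
case: (boolP (P y)) => [Py _|nPy /= hs].
  exists [::], y; split=> //; first by rewrite /= !ipath_cons xy.
  by move=> z; rewrite mem_seq1 => /eqP->; rewrite mem_head.
have [p [a [yp Pa nPp ps]]] := IHs y ys nPy hs.
have [|p1 [q [eq_p q0 xq]]] := ipath_extend (x := x) yp; first by rewrite /= xy.
(* Being a nonempty suffix, [q] still ends in [a]. *)
case/lastP: q => // q b in eq_p q0 xq *.
move: eq_p; rewrite -rcons_cons -rcons_cat => /rcons_inj[eq_p ab]; subst b.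
exists q, a; split=> //.
  move=> z zq; have: z \in y :: p by rewrite eq_p mem_cat zq orbT.
  by rewrite in_cons => /predU1P[->|/nPp].
move=> z; rewrite mem_rcons in_cons => /predU1P[->|zq].
  by rewrite in_cons ps ?orbT // mem_rcons mem_head.
have: z \in y :: p by rewrite eq_p mem_cat zq orbT.
rewrite !in_cons => /predU1P[->|zp]; first by rewrite eqxx.
by rewrite ps ?orbT // mem_rcons in_cons zp orbT.
Qed.

Lemma ipath_nth x0 s i j : ipath s -> i < j -> j < size s ->
  nth x0 s i -- nth x0 s j = (j == i.+1).
Proof.
elim: s i j => // x s IHs [|i] [|j] //; rewrite ipath_cons => /andP[xs sp] /=.
  case: s xs sp {IHs} => // y s /andP[xy /all_nthP xs] _ _.
  by case: j => [_|j lt_j] //=; apply/negbTE/xs.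
by rewrite !ltnS => ij js; rewrite IHs.
Qed.

End InducedPaths.

(** * Forbidden induced subgraphs *)

Ltac split_andb :=
  repeat match goal with H : is_true (_ && _) |- _ => case/andP: H => ? ? end.

Ltac adj_auto :=
  rewrite ?ipath_cons /=; split_andb; repeat (apply/andP; split);
  first [ done | assumption | by rewrite adj_sym | by rewrite adj_irr ].

Ltac adj_contra :=
  match goal with
  | h : is_true ?b, h' : is_true (~~ ?b) |- _ => by rewrite h in h'
  | h : is_true (adj ?x ?y), h' : is_true (~~ adj ?y ?x) |- _ =>
      by rewrite adj_sym h in h'
  end.

(** Two vertices are told apart by a third one that sees only one of them. *)
Ltac adj_neq := apply/eqP => ?; subst; first [adj_contra | done].

Ltac pick_disjunct tac :=
  first [by tac | apply/orP; left; by tac | apply/orP; right; pick_disjunct tac].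

Section ForbiddenSubgraphs.

Variable G : sgraph.
Implicit Types (a b c d u v w x y z : G) (A B K Q : {set G}).

Lemma induced_nth n (e : rel 'I_n) (r : rel nat) (s : seq G) x0 :
    (forall i j, e i j = r i j) -> size s = n -> uniq s ->
    (forall i j, i < n -> j < n -> nth x0 s i -- nth x0 s j = r i j) ->
  exists f : 'I_n -> G, injective f /\ forall i j, f i -- f j = e i j.
Proof.
move=> er sn us sr; exists (fun i : 'I_n => nth x0 s i); split=> [i j|i j].
  by move/eqP; rewrite nth_uniq ?sn // => /eqP/val_inj.
by rewrite sr // er.
Qed.

Definition twin_free n (r : rel nat) :=
  all (fun i => all (fun j => all (fun k => r i k == r j k) (iota 0 n)
    ==> (i == j)) (iota 0 n)) (iota 0 n).

(** Equal entries would have equal rows in the pattern [r]. Since [twin_free] evaluates,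
    distinctness in P7, C7 and P4 follows by computation. *)
Lemma twin_free_uniq n (r : rel nat) (s : seq G) x0 :
    twin_free n r -> size s = n ->
    (forall i j, i < n -> j < n -> nth x0 s i -- nth x0 s j = r i j) -> uniq s.
Proof.
move=> tf sn sr; apply/(uniqP x0) => i j; rewrite !inE sn => iN jN ij.
have mem k : k < n -> k \in iota 0 n by rewrite mem_iota.
move/allP/(_ _ (mem i iN))/allP/(_ _ (mem j jN))/implyP: tf => tf.
apply/eqP/tf/allP => k; rewrite mem_iota /= add0n => kn.
by rewrite -!sr // ij.
Qed.

Hypothesis P7_free : free_of (path_graph 7) G.
Hypothesis C7_free : free_of (cycle_graph 7) G.
Hypothesis C4_free : free_of (cycle_graph 4) G.
Hypothesis gem_free : free_of gem G.

Lemma no_long_ipath (s : seq G) : ipath s -> 7 <= size s -> False.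
Proof.
case: s => // x0 t; move: (x0 :: t) => s sp s7.
have {}sp : ipath (take 7 s) by apply: (@ipath_cat_l _ _ (drop 7 s)); rewrite cat_take_drop.
have sz : size (take 7 s) = 7 by rewrite size_takel.
pose r : rel nat := fun i j => (j == i.+1) || (i == j.+1).
have sr i j : i < 7 -> j < 7 -> nth x0 (take 7 s) i -- nth x0 (take 7 s) j = r i j.
  move=> i7 j7; rewrite /r; case: (ltngtP i j) => [ij|ji|->].
  - rewrite ipath_nth ?sz // [i == _]ltn_eqF ?orbF //.
    exact: ltnW.
  - by rewrite adj_sym ipath_nth ?sz // [j == _]ltn_eqF // ltnW.
  - by rewrite adj_irr orbb ltn_eqF.
by apply: P7_free; apply: (induced_nth (r := r) _ sz (twin_free_uniq _ sz sr) sr).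
Qed.

Lemma no_C7 (v a b c d e f : G) : ipath [:: a; b; c; d; e; f] ->
  v -- a -> v -- f -> ~~ v -- b -> ~~ v -- c -> ~~ v -- d -> ~~ v -- e -> False.
Proof.
move=> sp va vf vb vc vd ve; pose s := [:: v; a; b; c; d; e; f].
pose r : rel nat := fun i j => (i != j) && ((j == i.+1 %% 7) || (i == j.+1 %% 7)).
have sr i j : i < 7 -> j < 7 -> nth v s i -- nth v s j = r i j.
  wlog: i j / i <= j.
    move=> wl i7 j7; case/orP: (leq_total i j) => ij; first exact: wl.
    by rewrite adj_sym wl // /r eq_sym orbC.
  rewrite leq_eqVlt => /predU1P[->|]; first by rewrite adj_irr /r eqxx.
  case: i j => [|i] [|j] // ij _ j7.
    case: j j7 {ij} => [|[|[|[|[|[|j]]]]]] //= _; first [done | exact/negbTE].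
  have := @ipath_nth _ v _ i j sp ij j7; rewrite /= => ->.
  by move: i j ij j7 => [|[|[|[|[|[|i]]]]]] [|[|[|[|[|[|j]]]]]].
have sz : size s = 7 by [].
by apply: C7_free; apply: (induced_nth (r := r) _ sz (twin_free_uniq _ sz sr) sr).
Qed.

(** Opposite vertices of a C4 are twins, so [twin_free_uniq] does not apply and their distinctness
    is assumed. *)
Lemma C4_chord (a b c d : G) : a -- b -> b -- c -> c -- d -> d -- a ->
  a != c -> b != d -> a -- c || b -- d.
Proof.
move=> ab bc cd da ac bd; apply/negPn/negP; rewrite negb_or => /andP[nac nbd].
pose s := [:: a; b; c; d].
have neq (x y : G) : x -- y -> x != y by apply: contraTneq => ->; rewrite adj_irr.
pose r : rel nat := fun i j => (i != j) && ((j == i.+1 %% 4) || (i == j.+1 %% 4)).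
have sr i j : i < 4 -> j < 4 -> nth a s i -- nth a s j = r i j.
  by case: i j => [|[|[|[|i]]]] [|[|[|[|j]]]] //= _ _;
    first [by rewrite adj_irr | by apply/negbTE | by rewrite adj_sym
          | by rewrite adj_sym; apply/negbTE].
apply: C4_free; apply: (induced_nth (r := r) (s := s)) sr => //=.
by rewrite !inE !negb_or ac bd !neq // adj_sym.
Qed.

Lemma no_gem (x a b c d : G) : x -- a -> x -- b -> x -- c -> x -- d ->
  ipath [:: a; b; c; d] -> False.
Proof.
move=> xa xb xc xd sp; pose s := [:: a; b; c; d].
have xs i : i < 4 -> x -- nth x s i by case: i => [|[|[|[|i]]]].
have sr i j : i < 4 -> j < 4 ->
    nth x s i -- nth x s j = (j == i.+1) || (i == j.+1).
  move=> i4 j4; case: (ltngtP i j) => [ij|ji|->].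
  - by rewrite ipath_nth // [i == _]ltn_eqF ?orbF // ltnW.
  - by rewrite adj_sym ipath_nth // [j == _]ltn_eqF // ltnW.
  - by rewrite adj_irr orbb ltn_eqF.
have us : uniq s by apply: (twin_free_uniq (n := 4)) sr.
apply: gem_free; exists (fun o : gem => if o is Some i then nth x s (i : 'I_4) else x).
split=> [[i|] [j|]|[i|] [j|]] //=.
- by move/eqP; rewrite nth_uniq ?ltn_ord // => /eqP/val_inj->.
- by move=> ix; have := xs i (ltn_ord i); rewrite ix adj_irr.
- by move=> ix; have := xs j (ltn_ord j); rewrite -ix adj_irr.
- by rewrite sr.
- by rewrite adj_sym xs.
- by rewrite xs.
- by rewrite adj_irr.
Qed.

(** * Components and boundaries *)

(** The component of [q] in the subgraph induced by [A]. For [q] outside [A] it degenerates to the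
    singleton of [q]. *)
Definition cc A q : {set G} :=
  [set y | connect [rel a b | [&& a -- b, a \in A & b \in A]] q y].

Lemma cc_refl A q : q \in cc A q.
Proof. by rewrite inE connect0. Qed.

Lemma cc_subset A q : q \in A -> cc A q \subset A.
Proof.
move=> qA; apply/subsetP => y; rewrite inE => /connectP[s].
elim: s q qA => [|z s IHs] q qA /= => [_ ->|/andP[/and3P[_ _ zA] zs] yE] //.
exact: IHs zs yE.
Qed.

Lemma cc_closed A q y z :
  q \in A -> y \in cc A q -> z \in A -> y -- z -> z \in cc A q.
Proof.
move=> qA yQ zA yz; have yA := subsetP (cc_subset qA) y yQ.
move: yQ; rewrite !inE => /connect_trans; apply.
by apply: connect1; rewrite /= yz yA.
Qed.

Lemma cc_walk A q y z : q \in A -> y \in cc A q -> z \in cc A q ->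
  exists s, [/\ path (@adj G) y s, last y s = z & {subset s <= cc A q}].
Proof.
move=> qA yQ; set e := [rel a b | [&& a -- b, a \in A & b \in A]] => zQ.
have e_sym : connect_sym e.
  by apply: sym_connect_sym => a b /=; rewrite adj_sym [(a \in A) && _]andbC.
have /connectP[s] : connect e y z.
  by move: yQ zQ; rewrite !inE -/e (e_sym q y); apply: connect_trans.
elim: s y yQ => [|w s IHs] y yQ /= => [_ ->|/andP[/and3P[yw _ wA] ws] zE].
  by exists [::].
have wQ := cc_closed qA yQ wA yw.
have [t [wt tz tQ]] := IHs w wQ ws zE; exists (w :: t).
by rewrite /= yw; split=> // v; rewrite in_cons => /predU1P[->|/tQ].
Qed.

Lemma cc_ind A q y0 (B : {set G}) : q \in A -> y0 \in cc A q -> y0 \in B ->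
    (forall y z, y \in cc A q -> y \in B -> z \in cc A q -> y -- z -> z \in B) ->
  cc A q \subset B.
Proof.
move=> qA y0Q y0B closed; apply/subsetP => z zQ.
have [s [y0s <- sQ]] := cc_walk qA y0Q zQ.
elim: s y0 y0Q y0B y0s sQ => //= w s IHs y yQ yB /andP[yw ws] sQ.
have wQ : w \in cc A q by rewrite sQ ?mem_head.
apply: IHs => //; first exact: closed yw.
by move=> v vs; rewrite sQ // in_cons vs orbT.
Qed.

Definition boundary Q : {set G} := [set u | (u \notin Q) && [exists q in Q, u -- q]].

Lemma boundaryP Q u :
  reflect (u \notin Q /\ exists2 q, q \in Q & u -- q) (u \in boundary Q).
Proof.
rewrite inE; apply: (iffP andP) => [[uQ /existsP[q /andP[]]]|[uQ [q qQ uq]]].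
  by split=> //; exists q.
by split=> //; apply/existsP; exists q; rewrite qQ.
Qed.

(** * Maximal cliques, their neighbourhoods and their far parts *)

Definition near K : {set G} := boundary K.
Definition far K : {set G} := ~: (K :|: near K).

Lemma cliqueP K :
  reflect {in K &, forall x y, x != y -> x -- y} (clique K).
Proof.
apply: (iffP forallP) => [cK x y xK yK xy|cK x].
  by have /implyP/(_ xK)/forallP/(_ y)/implyP/(_ yK)/implyP/(_ xy) := cK x.
apply/implyP => xK; apply/forallP => y; apply/implyP => yK; apply/implyP.
exact: cK.
Qed.

Lemma far_anti K k q : k \in K -> q \in far K -> ~~ k -- q.
Proof.
rewrite !inE negb_or => kK /andP[-> /= /existsPn/(_ k)].
by rewrite kK adj_sym.
Qed.

Lemma far_notin K q : q \in far K -> q \notin K.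
Proof. by rewrite !inE negb_or => /andP[]. Qed.

(** Maximal for inclusion, not necessarily of size [omega G]; so every edge extends to such a
    clique, as the descent requires. *)
Definition max_clique K := maxset (fun A : {set G} => clique A) K.

Lemma max_clique_clique K : max_clique K -> {in K &, forall x y, x != y -> x -- y}.
Proof. by move/maxsetp/cliqueP. Qed.

(** Otherwise [u |: K] would be a larger clique. *)
Lemma max_clique_nonadj K u : max_clique K -> u \notin K ->
  exists2 k, k \in K & ~~ k -- u.
Proof.
move=> mK uK; apply/exists_inP; apply: contraNT uK => /exists_inPn Ku.
have cK := max_clique_clique mK.
suff cKu : clique (u |: K).
  by rewrite -(maxsetsup mK cKu (subsetUr _ _)) setU11.
have uk k : k \in K -> k -- u by move/Ku; rewrite negbK.
apply/cliqueP => x y; rewrite !inE => /predU1P[->|xK] /predU1P[->|yK].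
- by rewrite eqxx.
- by rewrite adj_sym uk.
- by rewrite uk.
- exact: cK.
Qed.

Lemma max_clique_extend x y : x -- y ->
  exists K, [/\ max_clique K, x \in K & y \in K].
Proof.
move=> xy; have cxy : clique [set x; y].
  apply/cliqueP => a b; rewrite !inE => /pred2P[]-> /pred2P[]->; rewrite ?eqxx //.
  by rewrite adj_sym.
have [K mK sK] := maxset_exists cxy; exists K; split=> //.
  by rewrite (subsetP sK) // set21.
by rewrite (subsetP sK) // set22.
Qed.

(** A boundary vertex in [far K] would belong to the component, and one in [K] would have no
    neighbour in [far K]. *)
Lemma boundary_near K q0 : q0 \in far K -> boundary (cc (far K) q0) \subset near K.
Proof.
move=> q0R; apply/subsetP => u /boundaryP[uQ [q qQ uq]].
have qR := subsetP (cc_subset q0R) q qQ.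
have uR : u \notin far K.
  by apply: contra uQ => uR; apply: (cc_closed q0R qQ uR); rewrite adj_sym.
have uK : u \notin K by apply: contraL uq => uK; apply: far_anti uK qR.
by move: uR; rewrite inE negbK in_setU (negbTE uK).
Qed.

(** The induced path [k], [x], [u] adds two vertices of [K] in front of any induced path from [u]
    into [far K]; this is how a P7 is reached. *)
Lemma near_stem K u : max_clique K -> u \in near K ->
  exists x k, [/\ x \in K, k \in K, x -- u, k -- x & ~~ k -- u].
Proof.
move=> mK /boundaryP[uK [x xK ux]].
have [k kK ku] := max_clique_nonadj mK uK.
exists x, k; split=> //; first by rewrite adj_sym.
by apply: (max_clique_clique mK) => //; apply: contraNneq ku => ->; rewrite adj_sym.
Qed.

(** If [u] misses [H], follow a walk from [u] through the component towards [c0], up to the first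
    vertex [a] with a neighbour in [H]. Shortened, preceded by the stem [k], [x] and continued by
    [c], [c'], [c''], it is an induced path on at least seven vertices. *)
Lemma touch K q0 (H : seq G) c0 u : max_clique K -> q0 \in far K ->
    {subset H <= cc (far K) q0} -> c0 \in H ->
    {in H, forall c, has (fun d => c -- d) H} ->
    (forall a, has (fun d => a -- d) H ->
      exists c c' c'', [/\ c \in H, c' \in H, c'' \in H & ipath [:: a; c; c'; c'']]) ->
  u \in boundary (cc (far K) q0) -> has (fun d => u -- d) H.
Proof.
move=> mK q0R HQ c0H Hnbr Hpath ubd; apply/negPn/negP => uH.
have QR := subsetP (cc_subset q0R).
have [x [k [xK kK xu kx ku]]] := near_stem mK (subsetP (boundary_near q0R) u ubd).
have /boundaryP[uQ [q qQ uq]] := ubd.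
have [s [qs sc0 sQ]] := cc_walk q0R qQ (HQ _ c0H).
have c0s : c0 \in q :: s by rewrite -sc0 mem_last.
have [||p [a [up Pa nPp ps]]] := @walk_ipath _ (fun a => has (fun d => a -- d) H) u (q :: s) _ uH.
- by rewrite /= uq.
- by apply/hasP; exists c0 => //; apply: Hnbr.
have pQ z : z \in rcons p a -> z \in cc (far K) q0.
  by move/ps; rewrite in_cons => /predU1P[->|/sQ].
have [c [c' [c'' [cH c'H c''H ac]]]] := Hpath a Pa.
have sH z : z \in [:: c; c'; c''] -> z \in H.
  by rewrite !inE => /or3P[]/eqP->.
have : ipath [:: k, x, u & rcons p a ++ [:: c; c'; c'']].
  have tR z : z \in rcons p a ++ [:: c; c'; c''] -> z \in far K.
    by rewrite mem_cat => /orP[/pQ/QR //|/sH/HQ/QR].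
  apply: ipath_cons2 => //.
    move=> z; rewrite in_cons => /predU1P[->//|/tR]; exact: far_anti.
  apply: ipath_cons2 => //.
    by move=> z /tR; apply: far_anti.
  rewrite -cat_cons -rcons_cons; apply: ipath_cat_last => // y z yp /sH zH.
  apply: contraL zH => yz; apply/negP => zH.
  have: ~~ has (fun d => y -- d) H.
    by move: yp; rewrite in_cons => /predU1P[->//|/nPp].
  by move/negP; apply; apply/hasP; exists z.
by move/no_long_ipath; apply; rewrite /= size_cat size_rcons /= !addnS.
Qed.

(** * Colouring chordal sets *)

Definition hole5 (c1 c2 c3 c4 c5 : G) :=
  [&& c1 -- c2, c2 -- c3, c3 -- c4, c4 -- c5, c5 -- c1,
      ~~ c1 -- c3, ~~ c1 -- c4, ~~ c2 -- c4, ~~ c2 -- c5 & ~~ c3 -- c5].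

Definition hole6 (c1 c2 c3 c4 c5 c6 : G) :=
  [&& c1 -- c2, c2 -- c3, c3 -- c4, c4 -- c5, c5 -- c6, c6 -- c1,
      ~~ c1 -- c3, ~~ c1 -- c4, ~~ c1 -- c5, ~~ c2 -- c4, ~~ c2 -- c5,
      ~~ c2 -- c6, ~~ c3 -- c5, ~~ c3 -- c6 & ~~ c4 -- c6].

Definition hole (s : seq G) :=
  match s with
  | [:: c1; c2; c3; c4; c5] => hole5 c1 c2 c3 c4 c5
  | [:: c1; c2; c3; c4; c5; c6] => hole6 c1 c2 c3 c4 c5 c6
  | _ => false
  end.

(* Only holes of length 5 and 6 matter: the others are forbidden in G, those of
   length at least 8 because they contain a P7. *)
Definition hole_free A := forall s, {subset s <= A} -> ~~ hole s.

Lemma hole_freeS A B : A \subset B -> hole_free B -> hole_free A.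
Proof. by move=> /subsetP AB fB s sA; apply: fB => z /sA/AB. Qed.

Definition simplicial A z :=
  {in A &, forall x y, z -- x -> z -- y -> x != y -> x -- y}.

Definition away A v : {set G} := [set y in A | (y != v) && ~~ v -- y].

(** If [v] missed [x], then [x] would lie in [away A v] and so in the component itself. *)
Lemma boundary_away A v w x : w \in away A v -> x \in A ->
  x \in boundary (cc (away A v) w) -> v -- x.
Proof.
move=> wA xA /boundaryP[xQ [q qQ xq]].
have := subsetP (cc_subset wA) q qQ; rewrite inE => /and3P[qA qv vq].
apply: contraR xQ => vx; apply: (cc_closed wA qQ); last by rewrite adj_sym.
by rewrite inE xA vx andbT; apply: contraNneq vq => <-.
Qed.

(* Two nonadjacent boundary vertices are joined by an induced path through the
   component, which v closes into a hole. *)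
Lemma boundary_away_clique A v w : hole_free A -> v \in A -> w \in away A v ->
  {in A :&: boundary (cc (away A v) w) &, forall x y, x != y -> x -- y}.
Proof.
move=> fA vA wA x y /setIP[xA xB] /setIP[yA yB] xy; apply/negPn/negP => nxy.
have vx := boundary_away wA xA xB; have vy := boundary_away wA yA yB.
have [xQ [q qQ xq]] := boundaryP _ _ xB; have [yQ [q' qQ' yq']] := boundaryP _ _ yB.
have [s [qs sq' sQ]] := cc_walk wA qQ qQ'.
have [||p [a [xp /eqP ay pny ps]]] := @walk_ipath _ (pred1 y) x (rcons (q :: s) y) _ xy.
- by rewrite /= xq rcons_path qs sq' adj_sym.
- by apply/hasP; exists y => /=; rewrite ?eqxx // in_cons mem_rcons mem_head orbT.
subst a; have pQ z : z \in p -> z \in cc (away A v) w.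
  move=> zp; have := ps z; rewrite !mem_rcons in_cons zp orbT => /(_ isT).
  rewrite in_cons => /predU1P[zy|]; first by have := pny z zp; rewrite /= zy eqxx.
  by rewrite in_cons => /predU1P[->|/sQ].
have pA z : z \in p -> [&& z \in A, v != z & ~~ v -- z].
  by move/pQ/(subsetP (cc_subset wA)); rewrite inE eq_sym.
have {}pA : all (fun z => [&& z \in A, v != z & ~~ v -- z]) p.
  by apply/allP.
have hA s' : all (mem A) s' -> ~~ hole s' by move/allP => sA'; apply: fA.
(* By the number of interior vertices: none contradicts [nxy], one gives a C4 through [v], two and
   three give a hole in [A], four a C7, and five or more make the path itself contain a P7. *)
case: p xp {ps pny pQ} pA => [|a1 [|a2 [|a3 [|a4 [|a5 p]]]]] xp /= pA.
- by move: xp; rewrite /= !ipath_cons (negbTE nxy).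
- move: xp; rewrite /= !ipath_cons /= => xp; split_andb.
  by have /orP[h|h] : v -- a1 || x -- y by [apply: C4_chord => //; adj_auto]; adj_contra.
- have /negP[] : ~~ hole [:: v; x; a1; a2; y].
    by apply: hA; adj_auto.
  move: xp; rewrite /= !ipath_cons /= => xp; rewrite /hole5; adj_auto.
- have /negP[] : ~~ hole [:: v; x; a1; a2; a3; y].
    by apply: hA; adj_auto.
  move: xp; rewrite /= !ipath_cons /= => xp; rewrite /hole6; adj_auto.
- move: xp; rewrite /= !ipath_cons /= => xp; split_andb.
  apply: (@no_C7 v x a1 a2 a3 a4 y); adj_auto.
- by apply: (no_long_ipath xp); rewrite /= size_rcons.
Qed.

(* Dirac's theorem, strengthened so that the induction goes through. *)
Lemma simplicial_away n A v w : #|A| <= n -> hole_free A -> v \in A ->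
  w \in away A v -> exists2 z, z \in away A v & simplicial A z.
Proof.
elim: n A v w => [|n IHn] A v w; first by rewrite leqn0 cards_eq0 => /eqP->; rewrite inE.
move=> cA fA vA wA; set Q := cc (away A v) w; set B := A :&: boundary Q.
have QA : Q \subset away A v := cc_subset wA.
have awA : away A v \subset A by apply/subsetP => z; rewrite inE => /andP[].
have vNaw : v \notin away A v by rewrite inE eqxx andbF.
have clB : {in B &, forall x y, x != y -> x -- y} := boundary_away_clique fA vA wA.
have Bv z : z \in B -> v -- z by case/setIP => zA; apply: boundary_away.
have nbrQ z x : z \in Q -> x \in A -> z -- x -> x \in Q :|: B.
  move=> zQ xA zx; case: (boolP (x \in Q)) => xQ; apply/setUP; [by left|right].
  by apply/setIP; split=> //; apply/boundaryP; split=> //; exists z; rewrite // adj_sym.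
(* The vertex [v] lies neither in [Q] nor in [B], so the induction hypothesis covers all subsets of
   [Q :|: B]. *)
have smaller A' : A' \subset Q :|: B -> (#|A'| <= n) /\ hole_free A'.
  move=> sA'.
  have sA'A : A' \subset A :\ v.
    apply/subsetP => z /(subsetP sA') zQB; rewrite !inE.
    case/setUP: zQB => [/(subsetP QA)|zB]; first by rewrite inE => /and3P[-> -> _].
    case/setIP: (zB) => -> _; rewrite andbT.
    by apply: contraTneq (Bv z zB) => ->; rewrite adj_irr.
  split; last by apply: hole_freeS fA; apply: subset_trans sA'A (subsetDl _ _).
  by rewrite -ltnS (leq_trans _ cA) // (cardsD1 v A) vA ltnS subset_leq_card.
(* If some [x] in [B] misses a vertex of [Q :|: B], induction yields a simplicial vertex away from
   [x]. It is not in the clique [B], hence in [Q], where [Q :|: B] contains all its neighbours in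
   [A]. *)
case: (boolP [exists x in B, [exists y, y \in away (Q :|: B) x]]) => [|/exists_inPn Bfull].
  case/exists_inP => x xB /existsP[y yaw]; have [c f] := smaller _ (subxx _).
  have xQB : x \in Q :|: B by rewrite inE xB orbT.
  have [z] := IHn _ _ _ c f xQB yaw; rewrite inE => /and3P[zQB zx xz] simp.
  have zQ : z \in Q.
    case/setUP: zQB => // zB; have := clB x z xB zB.
    by rewrite eq_sym zx (negbTE xz) => /(_ isT).
  exists z; first exact: (subsetP QA).
  by move=> a b aA bA za zb; apply: simp => //; apply: (nbrQ z).
have BQ x q : x \in B -> q \in Q -> x -- q.
  move=> xB qQ; have /existsPn/(_ q) := Bfull x xB.
  rewrite inE in_setU qQ /= negb_and !negbK => /orP[/eqP qx|//]; subst q.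
  by have /setIP[_ /boundaryP[]] := xB; rewrite -/Q qQ.
(* Now the clique [B] is complete to [Q], so a vertex simplicial in [Q] is simplicial in [A]. Such a
   vertex comes by induction, or trivially if [Q] is a clique. *)
suff [z zQ simp] : exists2 z, z \in Q & simplicial Q z.
  exists z; first exact: (subsetP QA).
  move=> a b aA bA za zb ab.
  case/setUP: (nbrQ _ _ zQ aA za) => [aQ|aB]; case/setUP: (nbrQ _ _ zQ bA zb) => [bQ|bB].
  - exact: simp.
  - by rewrite adj_sym BQ.
  - exact: BQ.
  - exact: clB.
case: (boolP [exists q in Q, [exists y, y \in away Q q]]) => [|/exists_inPn Qfull].
  case/exists_inP => q qQ /existsP[y yaw]; have [c f] := smaller _ (subsetUl Q B).
  have [z zaw simp] := IHn _ _ _ c f qQ yaw; exists z => //.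
  by move: zaw; rewrite inE => /andP[].
exists w; first exact: cc_refl.
move=> a b aQ bQ _ _ ab; have /existsPn/(_ b) := Qfull a aQ.
by rewrite inE bQ eq_sym ab negbK.
Qed.

Lemma simplicial_exists A : hole_free A -> A != set0 ->
  exists2 z, z \in A & simplicial A z.
Proof.
move=> fA /set0Pn[v vA].
case: (boolP [exists q in A, [exists y, y \in away A q]]) => [|/exists_inPn Afull].
  case/exists_inP => q qA /existsP[y yaw].
  have [z zaw simp] := simplicial_away (leqnn _) fA qA yaw; exists z => //.
  by move: zaw; rewrite inE => /andP[].
exists v => // a b aA bA _ _ ab; have /existsPn/(_ b) := Afull a aA.
by rewrite inE bA eq_sym ab negbK.
Qed.

Definition coloring A k (c : G -> nat) :=
  {in A, forall x, c x < k} /\ {in A &, forall x y, x -- y -> c x != c y}.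

(** Colour greedily, a simplicial vertex [z] last: [z] and its neighbours in [A] form a clique, so
    fewer than [k] colours are forbidden at [z]. *)
Lemma hole_free_coloring A k : hole_free A ->
    (forall C : {set G}, C \subset A -> clique C -> #|C| <= k) ->
  exists c : G -> nat, coloring A k c.
Proof.
have [n] := ubnP #|A|; elim: n A => // n IHn A cA fA wA.
have [A0|A0] := eqVneq A set0.
  by exists (fun=> 0); split=> x; rewrite A0 inE.
have [z zA simp] := simplicial_exists fA A0.
have sA' : A :\ z \subset A by apply: subsetDl.
have [||C sC|c [ck cadj]] := IHn (A :\ z).
- by move: cA; rewrite (cardsD1 z A) zA.
- exact: hole_freeS fA.
- by apply: wA; apply: subset_trans sC sA'.
pose D := [set x in A | z -- x].
have zD : z \notin D by rewrite inE adj_irr andbF.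
have Dk : #|D| < k.
  have : #|z |: D| <= k.
    apply: wA; first by rewrite subUset sub1set zA; apply/subsetP => x; rewrite inE => /andP[].
    apply/cliqueP => x y; rewrite !inE.
    move=> /predU1P[->|/andP[xA zx]] /predU1P[->|/andP[yA zy]]; rewrite ?eqxx //.
      by rewrite adj_sym.
    exact: simp.
  by rewrite cardsU1 zD.
have [i ik iD] : exists2 i, i < k & {in D, forall x, c x != i}.
  have /hasP[i] : has (fun i => i \notin [seq c x | x in D]) (iota 0 k).
    apply: contraTT Dk => /hasPn sub; rewrite -leqNgt -(size_iota 0 k).
    rewrite -(size_image c D); apply: uniq_leq_size (iota_uniq _ _) _ => i /sub.
    by rewrite negbK.
  rewrite mem_iota /= add0n => ik iD; exists i => // x xD.
  by apply: contraNneq iD => <-; apply: image_f.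
exists (fun x => if x == z then i else c x); split=> [x xA|x y xA yA xy].
  by case: (eqVneq x z) => // xz; apply: ck; rewrite !inE xz.
case: (eqVneq x z) => [xz|xz]; case: (eqVneq y z) => [yz|yz].
- by move: xy; rewrite xz yz adj_irr.
- by rewrite eq_sym iD // inE yA -xz.
- by rewrite iD // inE xA -yz adj_sym.
- by apply: cadj; rewrite // !inE ?xz ?yz.
Qed.

(** * Neighbours of holes far from a maximal clique *)

(** Otherwise [a], [c1], [c2], [c3] would induce a C4. *)
Lemma nbr_between a c1 c2 c3 : c1 -- c2 -> c2 -- c3 -> ~~ c1 -- c3 ->
  c1 != c3 -> a != c2 -> [&& a -- c1 & a -- c3] ==> a -- c2.
Proof.
move=> c12 c23 nc13 c13 ac2; apply/implyP => /andP[ac1 ac3].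
have /orP[//|h] : a -- c2 || c1 -- c3; last adj_contra.
by apply: C4_chord; rewrite // adj_sym.
Qed.

Ltac between := apply: nbr_between; first [adj_auto | adj_neq].

Lemma nbr_not_P4 a c1 c2 c3 c4 : ipath [:: c1; c2; c3; c4] ->
  ~~ [&& a -- c1, a -- c2, a -- c3 & a -- c4].
Proof. by move=> p; apply/negP => /and4P[? ? ? ?]; apply: (no_gem (x := a)) p. Qed.

(** Such a [u] would join its stem [k], [x] to the path [c1], ..., [c4] into a P7. *)
Lemma nbr_not_end K u c1 c2 c3 c4 : max_clique K -> u \in near K ->
    {subset [:: c1; c2; c3; c4] <= far K} -> ipath [:: c1; c2; c3; c4] ->
  ~~ [&& u -- c1, ~~ u -- c2, ~~ u -- c3 & ~~ u -- c4].
Proof.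
move=> mK uN cR p; apply/negP => /and4P[uc1 uc2 uc3 uc4].
have [x [k [xK kK xu kx ku]]] := near_stem mK uN.
apply: (@no_long_ipath [:: k, x, u & [:: c1; c2; c3; c4]]) => //.
apply: ipath_cons2 => //.
  by move=> z; rewrite in_cons => /predU1P[->//|/cR]; apply: far_anti.
apply: ipath_cons2 => //; first by move=> z /cR; apply: far_anti.
by apply: ipath_cons2 => // z; rewrite !inE => /or3P[]/eqP->.
Qed.

(** For [a] off the hole, a gap of exactly one non-neighbour gives a C4 and no gap at all a gem. So
    some neighbour is followed by two non-neighbours. *)
Lemma hole5_nbr c1 c2 c3 c4 c5 a : hole5 c1 c2 c3 c4 c5 ->
    [|| a -- c1, a -- c2, a -- c3, a -- c4 | a -- c5] ->
  [|| [&& a -- c1, ~~ a -- c2 & ~~ a -- c3], [&& a -- c2, ~~ a -- c3 & ~~ a -- c4],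
      [&& a -- c3, ~~ a -- c4 & ~~ a -- c5], [&& a -- c4, ~~ a -- c5 & ~~ a -- c1]
    | [&& a -- c5, ~~ a -- c1 & ~~ a -- c2]].
Proof.
rewrite /hole5 => h; split_andb.
have [->|a1] := eqVneq a c1; first by move=> _; pick_disjunct adj_auto.
have [->|a2] := eqVneq a c2; first by move=> _; pick_disjunct adj_auto.
have [->|a3] := eqVneq a c3; first by move=> _; pick_disjunct adj_auto.
have [->|a4] := eqVneq a c4; first by move=> _; pick_disjunct adj_auto.
have [->|a5] := eqVneq a c5; first by move=> _; pick_disjunct adj_auto.
have f1 : [&& a -- c1 & a -- c3] ==> a -- c2 by between.
have f2 : [&& a -- c2 & a -- c4] ==> a -- c3 by between.
have f3 : [&& a -- c3 & a -- c5] ==> a -- c4 by between.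
have f4 : [&& a -- c4 & a -- c1] ==> a -- c5 by between.
have f5 : [&& a -- c5 & a -- c2] ==> a -- c1 by between.
have g1 : ~~ [&& a -- c1, a -- c2, a -- c3 & a -- c4]
  by apply: nbr_not_P4; adj_auto.
move: f1 f2 f3 f4 f5 g1.
by case: (a -- c1); case: (a -- c2); case: (a -- c3); case: (a -- c4); case: (a -- c5).
Qed.

Lemma hole6_nbr c1 c2 c3 c4 c5 c6 a : hole6 c1 c2 c3 c4 c5 c6 ->
    [|| a -- c1, a -- c2, a -- c3, a -- c4, a -- c5 | a -- c6] ->
  [|| [&& a -- c1, ~~ a -- c2 & ~~ a -- c3], [&& a -- c2, ~~ a -- c3 & ~~ a -- c4],
      [&& a -- c3, ~~ a -- c4 & ~~ a -- c5], [&& a -- c4, ~~ a -- c5 & ~~ a -- c6],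
      [&& a -- c5, ~~ a -- c6 & ~~ a -- c1] | [&& a -- c6, ~~ a -- c1 & ~~ a -- c2]].
Proof.
rewrite /hole6 => h; split_andb.
have [->|a1] := eqVneq a c1; first by move=> _; pick_disjunct adj_auto.
have [->|a2] := eqVneq a c2; first by move=> _; pick_disjunct adj_auto.
have [->|a3] := eqVneq a c3; first by move=> _; pick_disjunct adj_auto.
have [->|a4] := eqVneq a c4; first by move=> _; pick_disjunct adj_auto.
have [->|a5] := eqVneq a c5; first by move=> _; pick_disjunct adj_auto.
have [->|a6] := eqVneq a c6; first by move=> _; pick_disjunct adj_auto.
have f1 : [&& a -- c1 & a -- c3] ==> a -- c2 by between.
have f2 : [&& a -- c2 & a -- c4] ==> a -- c3 by between.
have f3 : [&& a -- c3 & a -- c5] ==> a -- c4 by between.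
have f4 : [&& a -- c4 & a -- c6] ==> a -- c5 by between.
have f5 : [&& a -- c5 & a -- c1] ==> a -- c6 by between.
have f6 : [&& a -- c6 & a -- c2] ==> a -- c1 by between.
have g1 : ~~ [&& a -- c1, a -- c2, a -- c3 & a -- c4]
  by apply: nbr_not_P4; adj_auto.
move: f1 f2 f3 f4 f5 f6 g1.
by case: (a -- c1); case: (a -- c2); case: (a -- c3); case: (a -- c4); case: (a -- c5);
  case: (a -- c6).
Qed.

(** The neighbour followed by two non-neighbours starts the path. [a] may lie on the hole, as
    [touch] requires. *)
Lemma hole_nbr s a : hole s -> has (fun d => a -- d) s ->
  exists c c' c'', [/\ c \in s, c' \in s, c'' \in s & ipath [:: a; c; c'; c'']].
Proof.
case: s => [|c1 [|c2 [|c3 [|c4 [|c5 [|c6 [|c7 s]]]]]]] //= h.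
  rewrite orbF => /(hole5_nbr h); move: h; rewrite /hole5 => h; split_andb.
  by case/or4P=> [||| /orP[]] h; split_andb;
    [exists c1, c2, c3 | exists c2, c3, c4 | exists c3, c4, c5 | exists c4, c5, c1
    | exists c5, c1, c2]; split; rewrite ?inE ?eqxx ?orbT //; adj_auto.
rewrite orbF => /(hole6_nbr h); move: h; rewrite /hole6 => h; split_andb.
by case/or4P=> [||| /or3P[]] h; split_andb;
  [exists c1, c2, c3 | exists c2, c3, c4 | exists c3, c4, c5 | exists c4, c5, c6
  | exists c5, c6, c1 | exists c6, c1, c2]; split; rewrite ?inE ?eqxx ?orbT //; adj_auto.
Qed.

Lemma hole_has s : hole s -> {in s, forall c, has (fun d => c -- d) s}.
Proof.
case: s => [|c1 [|c2 [|c3 [|c4 [|c5 [|c6 [|c7 s]]]]]]] //= h c.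
  rewrite /hole5 in h; split_andb; rewrite !inE.
  by case/or4P=> [||| /orP[]]/eqP->; pick_disjunct adj_auto.
rewrite /hole6 in h; split_andb; rewrite !inE.
by case/or4P=> [||| /or3P[]]/eqP->; pick_disjunct adj_auto.
Qed.

Lemma near_far_neq K u c : u \in near K -> c \in far K -> u != c.
Proof. by move=> uN; apply: contraTneq => <-; rewrite in_setC in_setU uN orbT. Qed.

Lemma clique_far_neq K y c : y \in K -> c \in far K -> y != c.
Proof. by move=> yK; apply: contraTneq => <-; rewrite in_setC in_setU yK. Qed.

(** Suppose [x] misses [u']. Take [x'] in [K] adjacent to [u'] and [k] in [K] not adjacent to [u].
    Excluding C4 forces [x' -- u] and forbids [k -- u']; then [x'] together with the path [u'], [u],
    [x], [k] is a gem. *)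
Lemma near_adj K u u' x : max_clique K -> u \in near K -> u' \in near K ->
  u -- u' -> x \in K -> x -- u -> x -- u'.
Proof.
move=> mK uN u'N uu' xK xu; apply/negPn/negP => xu'.
have cK := max_clique_clique mK.
have [x' [_ [x'K _ x'u' _ _]]] := near_stem mK u'N.
have [_ [k [_ kK _ _ ku]]] := near_stem mK uN.
have xx' : x -- x' by apply: cK => //; adj_neq.
have xk : x -- k by apply: cK => //; adj_neq.
have notK y v : y \in K -> v \in near K -> y != v.
  by move=> yK /boundaryP[vK _]; apply: contraNneq vK => <-.
have x'u : x' -- u.
  have /orP[h|//] : x -- u' || x' -- u; last adj_contra.
  by apply: C4_chord; rewrite ?notK //; adj_auto.
have x'k : x' -- k by apply: cK => //; adj_neq.
have ku' : ~~ k -- u'.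
  apply/negP => ku'; have /orP[h|h] : x -- u' || k -- u; try adj_contra.
  by apply: C4_chord; rewrite ?notK //; adj_auto.
by apply: (@no_gem x' u' u x k); adj_auto.
Qed.

Lemma common_nbr_adj a b c d : a -- c -> b -- c -> a -- d -> b -- d ->
  ~~ c -- d -> c != d -> a != b -> a -- b.
Proof.
move=> ac bc ad bd ncd cd ab; have /orP[//|h] : a -- b || c -- d; last adj_contra.
by apply: C4_chord; rewrite // adj_sym.
Qed.

(* u plays the role of c1 on the hole c1 ... c5. *)
Definition clone c5 c1 c2 c3 c4 u :=
  [&& u -- c5, u -- c1, u -- c2, ~~ u -- c3 & ~~ u -- c4].

(** Around the hole, a gap of one non-neighbour gives a C4, no gap a gem, and a gap of three or more
    a P7 by [nbr_not_end]. All gaps thus have length two, and a C5 has room for only one. *)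
Lemma hole5_clone K c1 c2 c3 c4 c5 u : max_clique K -> u \in near K ->
    hole5 c1 c2 c3 c4 c5 -> {subset [:: c1; c2; c3; c4; c5] <= far K} ->
    [|| u -- c1, u -- c2, u -- c3, u -- c4 | u -- c5] ->
  [|| clone c5 c1 c2 c3 c4 u, clone c1 c2 c3 c4 c5 u, clone c2 c3 c4 c5 c1 u,
      clone c3 c4 c5 c1 c2 u | clone c4 c5 c1 c2 c3 u].
Proof.
move=> mK uN; rewrite /hole5 /clone => h /allP /= cR; split_andb.
have [? ? ? ? ?] : [/\ u != c1, u != c2, u != c3, u != c4 & u != c5].
  by split; apply: (near_far_neq uN).
have f1 : [&& u -- c1 & u -- c3] ==> u -- c2 by between.
have f2 : [&& u -- c2 & u -- c4] ==> u -- c3 by between.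
have f3 : [&& u -- c3 & u -- c5] ==> u -- c4 by between.
have f4 : [&& u -- c4 & u -- c1] ==> u -- c5 by between.
have f5 : [&& u -- c5 & u -- c2] ==> u -- c1 by between.
have g1 : ~~ [&& u -- c1, u -- c2, u -- c3 & u -- c4]
  by apply: nbr_not_P4; adj_auto.
have g2 : ~~ [&& u -- c2, u -- c3, u -- c4 & u -- c5]
  by apply: nbr_not_P4; adj_auto.
have g3 : ~~ [&& u -- c3, u -- c4, u -- c5 & u -- c1]
  by apply: nbr_not_P4; adj_auto.
have g4 : ~~ [&& u -- c4, u -- c5, u -- c1 & u -- c2]
  by apply: nbr_not_P4; adj_auto.
have g5 : ~~ [&& u -- c5, u -- c1, u -- c2 & u -- c3]
  by apply: nbr_not_P4; adj_auto.
have e1 : ~~ [&& u -- c1, ~~ u -- c2, ~~ u -- c3 & ~~ u -- c4]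
  by apply: (nbr_not_end mK uN); [apply/allP|]; adj_auto.
have e2 : ~~ [&& u -- c2, ~~ u -- c3, ~~ u -- c4 & ~~ u -- c5]
  by apply: (nbr_not_end mK uN); [apply/allP|]; adj_auto.
have e3 : ~~ [&& u -- c3, ~~ u -- c4, ~~ u -- c5 & ~~ u -- c1]
  by apply: (nbr_not_end mK uN); [apply/allP|]; adj_auto.
have e4 : ~~ [&& u -- c4, ~~ u -- c5, ~~ u -- c1 & ~~ u -- c2]
  by apply: (nbr_not_end mK uN); [apply/allP|]; adj_auto.
have e5 : ~~ [&& u -- c5, ~~ u -- c1, ~~ u -- c2 & ~~ u -- c3]
  by apply: (nbr_not_end mK uN); [apply/allP|]; adj_auto.
move: f1 f2 f3 f4 f5 g1 g2 g3 g4 g5 e1 e2 e3 e4 e5.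
by case: (u -- c1); case: (u -- c2); case: (u -- c3); case: (u -- c4); case: (u -- c5).
Qed.

(** If [u -- u'], a neighbour [x] of both in [K] makes [u] the centre of a gem. If not, a common
    neighbour in [K] would form a C4 with [u], [c1], [u']; so their neighbours in [K] differ, and
    [u], [x], [x'], [u'], [c3], [c4], [c5] is a C7. *)
Lemma clones_not_consecutive K c1 c2 c3 c4 c5 u u' :
    max_clique K -> u \in near K -> u' \in near K ->
    hole5 c1 c2 c3 c4 c5 -> {subset [:: c1; c2; c3; c4; c5] <= far K} ->
  clone c5 c1 c2 c3 c4 u -> clone c1 c2 c3 c4 c5 u' -> False.
Proof.
move=> mK uN u'N; rewrite /hole5 /clone => h /allP /= cR cu cu'; split_andb.
have [x [_ [xK _ xu _ _]]] := near_stem mK uN.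
have [x' [_ [x'K _ x'u' _ _]]] := near_stem mK u'N.
have far1 : ~~ x -- c1 by exact: far_anti xK _.
have far3 : ~~ x -- c3 by exact: far_anti xK _.
have far4 : ~~ x -- c4 by exact: far_anti xK _.
have far5 : ~~ x -- c5 by exact: far_anti xK _.
have far1' : ~~ x' -- c1 by exact: far_anti x'K _.
have far3' : ~~ x' -- c3 by exact: far_anti x'K _.
have far4' : ~~ x' -- c4 by exact: far_anti x'K _.
have far5' : ~~ x' -- c5 by exact: far_anti x'K _.
have [uu'|nuu'] := boolP (u -- u').
  have xu' := near_adj mK uN u'N uu' xK xu.
  by apply: (@no_gem u x u' c1 c5); adj_auto.
have neq : u != u' by adj_neq.
have disj y : y \in K -> y -- u -> ~~ y -- u'.
  move=> yK yu; apply/negP => yu'.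
  have yc1 : y != c1 by apply: (clique_far_neq yK).
  have /orP[h|h] : y -- c1 || u -- u'; last adj_contra.
    by apply: C4_chord; adj_auto.
  by move: h; apply/negP; apply: far_anti yK _.
have xu' := disj x xK xu.
have x'u : ~~ x' -- u by apply: contraL x'u' => /(disj _ x'K).
have xx' : x -- x' by apply: (max_clique_clique mK) => //; adj_neq.
by apply: (@no_C7 u x x' u' c3 c4 c5); adj_auto.
Qed.

Definition antipodal c1 c2 c3 c4 c5 c6 u :=
  [&& u -- c1, u -- c4, ~~ u -- c2, ~~ u -- c3, ~~ u -- c5 & ~~ u -- c6].

(** All gaps have length two, as for a C5. A single gap would leave four consecutive neighbours and
    a gem, so there are two gaps separated by single neighbours. *)
Lemma hole6_antipodal K c1 c2 c3 c4 c5 c6 u : max_clique K -> u \in near K ->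
    hole6 c1 c2 c3 c4 c5 c6 -> {subset [:: c1; c2; c3; c4; c5; c6] <= far K} ->
    [|| u -- c1, u -- c2, u -- c3, u -- c4, u -- c5 | u -- c6] ->
  [|| antipodal c1 c2 c3 c4 c5 c6 u, antipodal c2 c3 c4 c5 c6 c1 u | antipodal c3 c4 c5 c6 c1 c2 u].
Proof.
move=> mK uN; rewrite /hole6 /antipodal => h /allP /= cR; split_andb.
have [? ? ?] : [/\ u != c1, u != c2 & u != c3] by split; apply: (near_far_neq uN).
have [? ? ?] : [/\ u != c4, u != c5 & u != c6] by split; apply: (near_far_neq uN).
have f1 : [&& u -- c1 & u -- c3] ==> u -- c2 by between.
have f2 : [&& u -- c2 & u -- c4] ==> u -- c3 by between.
have f3 : [&& u -- c3 & u -- c5] ==> u -- c4 by between.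
have f4 : [&& u -- c4 & u -- c6] ==> u -- c5 by between.
have f5 : [&& u -- c5 & u -- c1] ==> u -- c6 by between.
have f6 : [&& u -- c6 & u -- c2] ==> u -- c1 by between.
have g1 : ~~ [&& u -- c1, u -- c2, u -- c3 & u -- c4]
  by apply: nbr_not_P4; adj_auto.
have g2 : ~~ [&& u -- c2, u -- c3, u -- c4 & u -- c5]
  by apply: nbr_not_P4; adj_auto.
have g3 : ~~ [&& u -- c3, u -- c4, u -- c5 & u -- c6]
  by apply: nbr_not_P4; adj_auto.
have g4 : ~~ [&& u -- c4, u -- c5, u -- c6 & u -- c1]
  by apply: nbr_not_P4; adj_auto.
have g5 : ~~ [&& u -- c5, u -- c6, u -- c1 & u -- c2]
  by apply: nbr_not_P4; adj_auto.
have g6 : ~~ [&& u -- c6, u -- c1, u -- c2 & u -- c3]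
  by apply: nbr_not_P4; adj_auto.
have e1 : ~~ [&& u -- c1, ~~ u -- c2, ~~ u -- c3 & ~~ u -- c4]
  by apply: (nbr_not_end mK uN); [apply/allP|]; adj_auto.
have e2 : ~~ [&& u -- c2, ~~ u -- c3, ~~ u -- c4 & ~~ u -- c5]
  by apply: (nbr_not_end mK uN); [apply/allP|]; adj_auto.
have e3 : ~~ [&& u -- c3, ~~ u -- c4, ~~ u -- c5 & ~~ u -- c6]
  by apply: (nbr_not_end mK uN); [apply/allP|]; adj_auto.
have e4 : ~~ [&& u -- c4, ~~ u -- c5, ~~ u -- c6 & ~~ u -- c1]
  by apply: (nbr_not_end mK uN); [apply/allP|]; adj_auto.
have e5 : ~~ [&& u -- c5, ~~ u -- c6, ~~ u -- c1 & ~~ u -- c2]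
  by apply: (nbr_not_end mK uN); [apply/allP|]; adj_auto.
have e6 : ~~ [&& u -- c6, ~~ u -- c1, ~~ u -- c2 & ~~ u -- c3]
  by apply: (nbr_not_end mK uN); [apply/allP|]; adj_auto.
move: f1 f2 f3 f4 f5 f6 g1 g2 g3 g4 g5 g6 e1 e2 e3 e4 e5 e6.
by case: (u -- c1); case: (u -- c2); case: (u -- c3); case: (u -- c4); case: (u -- c5);
  case: (u -- c6).
Qed.

(** Distinct [u] and [u'] share the nonadjacent neighbours [c1] and [c4], so they are adjacent by
    C4-freeness and [near_adj] applies. *)
Lemma antipodal_near_eq K c1 c2 c3 c4 c5 c6 u u' x : max_clique K ->
    u \in near K -> u' \in near K -> hole6 c1 c2 c3 c4 c5 c6 ->
    antipodal c1 c2 c3 c4 c5 c6 u -> antipodal c1 c2 c3 c4 c5 c6 u' ->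
  x \in K -> x -- u -> x -- u'.
Proof.
move=> mK uN u'N; rewrite /hole6 /antipodal => h ou ou' xK xu; split_andb.
have [<-//|uu'] := eqVneq u u'.
apply: (near_adj mK uN u'N _ xK xu).
apply: (@common_nbr_adj _ _ c1 c4) => //.
by adj_neq.
Qed.

(** An edge [u -- u'] would close a C4 with [c1] and [c2]. Without it, and if the conclusion failed,
    [u], [x], [x'], [u'], [c5], [c6], [c1] would be a C7. *)
Lemma antipodal_consecutive K c1 c2 c3 c4 c5 c6 u u' x x' : max_clique K ->
    u \in near K -> u' \in near K -> hole6 c1 c2 c3 c4 c5 c6 ->
    {subset [:: c1; c2; c3; c4; c5; c6] <= far K} ->
    antipodal c1 c2 c3 c4 c5 c6 u -> antipodal c2 c3 c4 c5 c6 c1 u' ->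
    x \in K -> x' \in K -> x -- u -> x' -- u' ->
  x -- u' || x' -- u.
Proof.
move=> mK uN u'N; rewrite /hole6 /antipodal => h /allP /= cR ou ou' xK x'K xu x'u'.
apply/negPn/negP; rewrite negb_or => xx'; split_andb.
have [f1 f5 f6] : [/\ ~~ x -- c1, ~~ x -- c5 & ~~ x -- c6] by split; apply: far_anti xK _.
have [f1' f5' f6'] : [/\ ~~ x' -- c1, ~~ x' -- c5 & ~~ x' -- c6] by split; apply: far_anti x'K _.
have nuu' : ~~ u -- u'.
  apply/negP => uu'; have /orP[h|h] : u -- c2 || c1 -- u'; try adj_contra.
  by apply: C4_chord; first [adj_auto | adj_neq].
have ? : x -- x' by apply: (max_clique_clique mK) => //; adj_neq.
by apply: (@no_C7 u x x' u' c5 c6 c1); adj_auto.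
Qed.

(** Any two of the three antipodal pairs are equal or, after a rotation of the hole, consecutive;
    [opp14] handles the wrap-around from the third pair to the first. *)
Lemma antipodal_nested K c1 c2 c3 c4 c5 c6 u u' x x' : max_clique K ->
    u \in near K -> u' \in near K -> hole6 c1 c2 c3 c4 c5 c6 ->
    {subset [:: c1; c2; c3; c4; c5; c6] <= far K} ->
    [|| antipodal c1 c2 c3 c4 c5 c6 u, antipodal c2 c3 c4 c5 c6 c1 u | antipodal c3 c4 c5 c6 c1 c2 u] ->
    [|| antipodal c1 c2 c3 c4 c5 c6 u', antipodal c2 c3 c4 c5 c6 c1 u' | antipodal c3 c4 c5 c6 c1 c2 u'] ->
    x \in K -> x' \in K -> x -- u -> x' -- u' ->
  x -- u' || x' -- u.
Proof.
move=> mK uN u'N h cR ou ou' xK x'K xu x'u'.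
have [h2 h3] : hole6 c2 c3 c4 c5 c6 c1 /\ hole6 c3 c4 c5 c6 c1 c2.
  by move: h; rewrite /hole6 => h; split; adj_auto.
have [R2 R3] : {subset [:: c2; c3; c4; c5; c6; c1] <= far K} /\
    {subset [:: c3; c4; c5; c6; c1; c2] <= far K}.
  by move/allP: cR => /= cR; split; apply/allP; adj_auto.
have opp14 v : antipodal c1 c2 c3 c4 c5 c6 v -> antipodal c4 c5 c6 c1 c2 c3 v.
  by rewrite /antipodal => ov; adj_auto.
have swap v v' y y' : y' -- v || y -- v' -> y -- v' || y' -- v by rewrite orbC.
case/or3P: ou => ou; case/or3P: ou' => ou'.
- by rewrite (antipodal_near_eq mK uN u'N h ou ou' xK xu).
- exact: (antipodal_consecutive mK uN u'N h cR).
- by apply: swap; apply: (antipodal_consecutive mK u'N uN h3 R3 ou' (opp14 _ ou)).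
- by apply: swap; apply: (antipodal_consecutive mK u'N uN h cR ou' ou).
- by rewrite (antipodal_near_eq mK uN u'N h2 ou ou' xK xu).
- exact: (antipodal_consecutive mK uN u'N h2 R2).
- exact: (antipodal_consecutive mK uN u'N h3 R3 ou (opp14 _ ou')).
- by apply: swap; apply: (antipodal_consecutive mK u'N uN h2 R2 ou' ou).
- by rewrite (antipodal_near_eq mK uN u'N h3 ou ou' xK xu).
Qed.

(** * A vertex complete to the boundary of a far component with a hole *)

Section FarHole.

Variables (K : {set G}) (q0 : G) (s : seq G).
Hypotheses (mK : max_clique K) (q0R : q0 \in far K).
Let Q := cc (far K) q0.
Hypotheses (sQ : {subset s <= Q}) (hs : hole s).

Lemma boundary_touch u : u \in boundary Q -> has (fun d => u -- d) s.
Proof.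
case: s sQ hs => [|c0 t] // tQ ht; apply: (touch mK q0R tQ (mem_head _ _)).
- exact: hole_has.
- by move=> a; apply: hole_nbr.
Qed.

Lemma boundary_ipath u : u \in boundary Q ->
  exists c c' c'', [/\ c \in Q, c' \in Q, c'' \in Q & ipath [:: u; c; c'; c'']].
Proof.
move/boundary_touch/(hole_nbr hs) => [c [c' [c'' [? ? ? ?]]]].
by exists c, c', c''; split=> //; apply: sQ.
Qed.

Lemma boundary5_dominator c1 c2 c3 c4 c5 : s = [:: c1; c2; c3; c4; c5] ->
  exists2 z, z \in Q & {in boundary Q, forall u, z -- u}.
Proof.
move=> sE; move: hs sQ boundary_touch; rewrite sE => h5 s5Q touch5.
have s5R : {subset [:: c1; c2; c3; c4; c5] <= far K}.
  by move=> c /s5Q; apply/subsetP/cc_subset.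
have clones u : u \in boundary Q -> [|| clone c5 c1 c2 c3 c4 u,
    clone c1 c2 c3 c4 c5 u, clone c2 c3 c4 c5 c1 u, clone c3 c4 c5 c1 c2 u
    | clone c4 c5 c1 c2 c3 u].
  move=> uB; apply: (hole5_clone mK _ h5 s5R).
    exact: subsetP (boundary_near q0R) u uB.
  by have := touch5 u uB; rewrite /= orbF.
(* As in [clone], the cloned vertex is the second argument. *)
pose B c5 c1 c2 c3 c4 := [exists u in boundary Q, clone c5 c1 c2 c3 c4 u].
have excl d1 d2 d3 d4 d5 : hole5 d1 d2 d3 d4 d5 ->
    {subset [:: d1; d2; d3; d4; d5] <= far K} ->
    ~~ (B d5 d1 d2 d3 d4 && B d1 d2 d3 d4 d5).
  move=> hd dR; apply/negP => /andP[/exists_inP[u uB cu] /exists_inP[u' u'B cu']].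
  have near_bd := subsetP (boundary_near q0R).
  exact: (clones_not_consecutive mK (near_bd u uB) (near_bd u' u'B) hd dR cu cu').
have [cQ1 [cQ2 [cQ3 [cQ4 cQ5]]]] : c1 \in Q /\ c2 \in Q /\ c3 \in Q /\ c4 \in Q /\ c5 \in Q.
  by do !split; apply: s5Q; rewrite !inE eqxx ?orbT.
move: (h5); rewrite /= /hole5 => h; split_andb; move/allP: s5R => /= s5R; split_andb.
have e1 : ~~ (B c5 c1 c2 c3 c4 && B c1 c2 c3 c4 c5).
  by apply: excl; [rewrite /hole5|apply/allP]; adj_auto.
have e2 : ~~ (B c1 c2 c3 c4 c5 && B c2 c3 c4 c5 c1).
  by apply: excl; [rewrite /hole5|apply/allP]; adj_auto.
have e3 : ~~ (B c2 c3 c4 c5 c1 && B c3 c4 c5 c1 c2).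
  by apply: excl; [rewrite /hole5|apply/allP]; adj_auto.
have e4 : ~~ (B c3 c4 c5 c1 c2 && B c4 c5 c1 c2 c3).
  by apply: excl; [rewrite /hole5|apply/allP]; adj_auto.
have e5 : ~~ (B c4 c5 c1 c2 c3 && B c5 c1 c2 c3 c4).
  by apply: excl; [rewrite /hole5|apply/allP]; adj_auto.
(* The vertices that are cloned are pairwise non-consecutive, so two consecutive
   ones are not cloned; the vertex opposite to these is adjacent to all clones. *)
have : [|| ~~ B c2 c3 c4 c5 c1 && ~~ B c3 c4 c5 c1 c2,
           ~~ B c3 c4 c5 c1 c2 && ~~ B c4 c5 c1 c2 c3,
           ~~ B c4 c5 c1 c2 c3 && ~~ B c5 c1 c2 c3 c4,
           ~~ B c5 c1 c2 c3 c4 && ~~ B c1 c2 c3 c4 c5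
         | ~~ B c1 c2 c3 c4 c5 && ~~ B c2 c3 c4 c5 c1].
  move: e1 e2 e3 e4 e5; case: (B c5 c1 c2 c3 c4); case: (B c1 c2 c3 c4 c5);
  case: (B c2 c3 c4 c5 c1); case: (B c3 c4 c5 c1 c2); by case: (B c4 c5 c1 c2 c3).
have no_clone d5 d1 d2 d3 d4 u : ~~ B d5 d1 d2 d3 d4 -> u \in boundary Q ->
    clone d5 d1 d2 d3 d4 u = false.
  by move=> /exists_inPn nB uB; apply/negbTE/nB.
case/or4P=> [||| /orP[]] /andP[n1 n2];
  [exists c1|exists c2|exists c3|exists c4|exists c5] => // u uB;
  have := clones u uB; rewrite (no_clone _ _ _ _ _ _ n1 uB) (no_clone _ _ _ _ _ _ n2 uB);
  rewrite /= ?orbF /clone => /or3P[] cu; split_andb; by rewrite adj_sym.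
Qed.

(** Choose a boundary vertex [u] with fewest neighbours in [K]. As these neighbourhoods form a
    chain, any neighbour of [u] in [K] sees the whole boundary. *)
Lemma boundary6_dominator c1 c2 c3 c4 c5 c6 u0 :
    s = [:: c1; c2; c3; c4; c5; c6] -> u0 \in boundary Q ->
  exists2 z, z \in K & {in boundary Q, forall u, z -- u}.
Proof.
move=> sE u0B; move: hs sQ boundary_touch; rewrite sE => h6 s6Q touch6.
have s6R : {subset [:: c1; c2; c3; c4; c5; c6] <= far K}.
  by move=> c /s6Q; apply/subsetP/cc_subset.
have near_bd := subsetP (boundary_near q0R).
have opps u : u \in boundary Q -> [|| antipodal c1 c2 c3 c4 c5 c6 u,
    antipodal c2 c3 c4 c5 c6 c1 u | antipodal c3 c4 c5 c6 c1 c2 u].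
  move=> uB; apply: (hole6_antipodal mK (near_bd u uB) h6 s6R).
  by have := touch6 u uB; rewrite /= orbF.
have nested u u' x x' : u \in boundary Q -> u' \in boundary Q ->
    x \in K -> x' \in K -> x -- u -> x' -- u' -> x -- u' || x' -- u.
  move=> uB u'B; apply: (antipodal_nested mK _ _ h6 s6R).
  - exact: near_bd.
  - exact: near_bd.
  - exact: opps.
  - exact: opps.
pose nb u := [set x in K | x -- u].
have [u uB umin] := arg_minnP (fun u => #|nb u|) u0B.
have [x [_ [xK _ xu _ _]]] := near_stem mK (near_bd u uB).
exists x => // u' u'B; apply/negPn/negP => xu'.
have : #|nb u'| < #|nb u|.
  apply: proper_card; apply/properP; split; last first.
    by exists x; rewrite inE xK.
  apply/subsetP => x'; rewrite !inE => /andP[x'K x'u']; rewrite x'K /=.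
  by have /orP[h|//] := nested _ _ _ _ uB u'B xK x'K xu x'u'; adj_contra.
by rewrite ltnNge umin.
Qed.

(** The dominator lies in [Q] for a C5 and in [K] for a C6; the descent relies only on its adjacency
    to the boundary. *)
Lemma boundary_dominator u0 : u0 \in boundary Q ->
  exists z, {in boundary Q, forall u, z -- u}.
Proof.
move=> u0B; have h := hs; move: (erefl s) h.
case: {2 3}s => [|c1 [|c2 [|c3 [|c4 [|c5 [|c6 [|c7 t]]]]]]] //= sE _.
  by have [z _ ?] := boundary5_dominator sE; exists z.
by have [z _ ?] := boundary6_dominator sE u0B; exists z.
Qed.

End FarHole.

(** * The descent *)

Lemma far_component_smaller K q0 s K' q1 s' z a : max_clique K -> q0 \in far K ->
    {subset s <= cc (far K) q0} -> hole s ->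
    max_clique K' -> q1 \in far K' -> {subset s' <= cc (far K') q1} -> hole s' ->
    z \in K' -> {in boundary (cc (far K) q0), forall u, z -- u} ->
    a \in K' -> a \in boundary (cc (far K) q0) ->
    boundary (cc (far K') q1) != set0 ->
  #|cc (far K') q1| < #|cc (far K) q0|.
Proof.
move=> mK q0R sQ hs mK' q1R s'Q hs' zK' zdom aK' aB /set0Pn[w wB].
set Q := cc (far K) q0 in sQ zdom aB *; set Q' := cc (far K') q1 in s'Q wB *.
have Q'R : {subset Q' <= far K'} := subsetP (cc_subset q1R).
have bd_notfar u : u \in boundary Q -> u \notin far K'.
  by move=> uB; apply: contraL (zdom u uB) => uR; apply: far_anti zK' uR.
have toQ c y : c \in Q -> c -- y -> y \in Q \/ y \in boundary Q.
  move=> cQ cy; case: (boolP (y \in Q)) => yQ; [by left|right].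
  by apply/boundaryP; split=> //; exists c; rewrite // adj_sym.
(* If [Q'] meets [Q], it cannot leave [Q], since it would have to cross [boundary Q], which is
   dominated by [z] and so avoids [far K']. The inclusion is strict because [a] has a neighbour in
   [Q]. *)
have [/exists_inP[y yQ' yQ]|/exists_inPn disj] := boolP [exists y in Q', y \in Q].
  apply: proper_card; apply/properP; split.
    apply: (cc_ind q1R yQ' yQ) => c d _ cQ dQ' cd.
    by case: (toQ c d cQ cd) => // /bd_notfar/negP[]; apply: Q'R.
  have /boundaryP[_ [b bQ ab]] := aB; exists b => //.
  by apply: contraL ab => /Q'R bR; apply: far_anti aK' bR.
exfalso.
have anti c d : c \in Q -> d \in Q' -> ~~ c -- d.
  move=> cQ dQ'; apply/negP => cd; case: (toQ c d cQ cd) => [|/bd_notfar/negP[]].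
    exact/negP/disj.
  exact: Q'R.
have [d [d' [d'' [dQ d'Q d''Q wd]]]] := boundary_ipath mK' q1R s'Q hs' wB.
have Qpath := boundary_ipath mK q0R sQ hs.
have /boundaryP[wQ' [e eQ' we]] := wB.
have wQ : w \notin Q by apply: contraL we => wQ; apply: anti.
(* Otherwise two induced P4s from [w], into [Q] and into [Q'], would form a P7. *)
have w_bd : w \notin boundary Q.
  apply/negP => /Qpath[c [c' [c'' [cQ c'Q c''Q wc]]]].
  have [? ? ?] : [/\ ~~ c -- d, ~~ c -- d' & ~~ c -- d''] by split; apply: anti.
  have [? ? ?] : [/\ ~~ c' -- d, ~~ c' -- d' & ~~ c' -- d''] by split; apply: anti.
  have [? ? ?] : [/\ ~~ c'' -- d, ~~ c'' -- d' & ~~ c'' -- d''] by split; apply: anti.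
  move: wc wd; rewrite !ipath_cons /= => wc wd.
  by apply: (@no_long_ipath [:: c''; c'; c; w; d; d'; d'']); adj_auto.
have outside y : y \notin Q -> y \notin boundary Q -> forall c, c \in Q -> ~~ y -- c.
  move=> yQ yB c cQ; apply: contra yB => yc; apply/boundaryP; split=> //.
  by exists c.
have w_out := outside w wQ w_bd.
have K'anti y : y \in K' -> ~~ y -- d /\ ~~ y -- d'.
  by move=> yK'; split; apply: far_anti yK' _; apply: Q'R.
(* Otherwise three vertices of [Q], then [y], [w] and two vertices of [Q'] would form a P7. *)
have w_notbd y : y \in K' -> y \in boundary Q -> ~~ w -- y.
  move=> yK' /Qpath[c [c' [c'' [cQ c'Q c''Q yc]]]]; apply/negP => wy.
  have [? ?] := K'anti y yK'.
  have [? ? ?] : [/\ ~~ w -- c, ~~ w -- c' & ~~ w -- c''] by split; apply: w_out.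
  have [? ? ?] : [/\ ~~ c -- d, ~~ c' -- d & ~~ c'' -- d] by split; apply: anti.
  have [? ? ?] : [/\ ~~ c -- d', ~~ c' -- d' & ~~ c'' -- d'] by split; apply: anti.
  move: yc wd; rewrite !ipath_cons /= => yc wd.
  by apply: (@no_long_ipath [:: c''; c'; c; y; w; d; d']); adj_auto.
(* The last P7 runs from [Q] through [a], then its neighbour [y] in [K'], then [w], into [Q']. *)
have /boundaryP[wK' [y yK' wy]] := subsetP (boundary_near q1R) w wB.
have y_bd : y \notin boundary Q by apply: contraL wy; apply: w_notbd.
have wa := w_notbd a aK' aB.
have ya : y -- a by apply: (max_clique_clique mK') => //; apply: contraNneq y_bd => ->.
have yQ : y \notin Q by apply: contraL wy => /w_out.
have y_out := outside y yQ y_bd.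
have [c [c' [c'' [cQ c'Q c''Q ac]]]] := Qpath a aB.
have [? ?] := K'anti y yK'; have [? ?] := K'anti a aK'.
have [? ?] : ~~ w -- c /\ ~~ w -- c' by split; apply: w_out.
have [? ?] : ~~ y -- c /\ ~~ y -- c' by split; apply: y_out.
have [? ?] : ~~ c -- d /\ ~~ c -- d' by split; apply: anti.
have [? ?] : ~~ c' -- d /\ ~~ c' -- d' by split; apply: anti.
move: ac wd; rewrite !ipath_cons /= => ac wd.
by apply: (@no_long_ipath [:: c'; c; a; y; w; d; d']); adj_auto.
Qed.

Lemma boundary_nonempty Q y z : connect (@adj G) y z -> y \in Q -> z \notin Q ->
  boundary Q != set0.
Proof.
move=> /connectP[s ys ->] yQ zQ; apply/set0Pn.
elim: s y ys yQ zQ => [|x s IHs] y /=; first by move=> _ ->.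
move=> /andP[yx xs] yQ zQ; case: (boolP (x \in Q)) => xQ; first exact: IHs xs xQ zQ.
by exists x; apply/boundaryP; split=> //; exists y; rewrite // adj_sym.
Qed.

Lemma cc_connect A q y : y \in cc A q -> connect (@adj G) q y.
Proof.
rewrite inE; apply: connect_sub => u v /and3P[uv _ _]; exact: connect1.
Qed.

Lemma hole_cc A s : hole s -> {subset s <= A} ->
  exists2 q, q \in s & {subset s <= cc A q}.
Proof.
move=> hs sA; case: s sA hs => [|c1 t] // tA ht; exists c1; first exact: mem_head.
have ext y z := @cc_closed A c1 y z (tA _ (mem_head _ _)).
apply/allP; move/allP: tA; move: ht ext.
case: t => [|c2 [|c3 [|c4 [|c5 [|c6 [|c7 t]]]]]] //= h ext tA;
  move: h; rewrite /hole5 /hole6 => h; split_andb;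
  have Q1 := cc_refl A c1;
  have Q2 : c2 \in cc A c1 by [apply: (ext c1)];
  have Q3 : c3 \in cc A c1 by [apply: (ext c2)];
  have Q4 : c4 \in cc A c1 by [apply: (ext c3)];
  have Q5 : c5 \in cc A c1 by [apply: (ext c4)].
  by rewrite Q1 Q2 Q3 Q4 Q5.
by have Q6 : c6 \in cc A c1 by [apply: (ext c5)]; rewrite Q1 Q2 Q3 Q4 Q5 Q6.
Qed.

Definition component r : {set G} := [set y | connect (@adj G) r y].

Lemma adj_connect_sym : connect_sym (@adj G).
Proof. exact/sym_connect_sym/adj_sym. Qed.

Lemma component_connect r x y : x \in component r -> y \in component r ->
  connect (@adj G) x y.
Proof. by rewrite !inE adj_connect_sym; apply: connect_trans. Qed.

(** Phrased as a refutation because [hole_free] is a proposition, not a boolean. Restricting to one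
    component of [G] keeps the boundaries in the descent nonempty. *)
Lemma good_clique r :
  (forall K, max_clique K -> K :&: component r != set0 ->
    ~ hole_free (far K :&: component r)) -> False.
Proof.
move=> bad.
(* A hole is connected, so it lies in a single component of the far part. *)
have step K : max_clique K -> K :&: component r != set0 ->
    (forall q s, q \in far K -> {subset s <= cc (far K) q} -> q \in component r ->
       hole s -> False) -> False.
  move=> mK Kr noh; apply: (bad K mK Kr) => s sA; apply/negP => hs.
  have sR : {subset s <= far K} by move=> c /sA; rewrite inE => /andP[].
  have [q qs sQ] := hole_cc hs sR.
  apply: (noh q s) => //; first exact: sR.
  by have := sA q qs; rewrite inE => /andP[].
(* Descent on the size of the far component that contains the hole. *)
suff key n : forall K q s, max_clique K -> K :&: component r != set0 ->
    q \in far K -> {subset s <= cc (far K) q} -> q \in component r -> hole s ->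
    #|cc (far K) q| < n -> False.
  have cr : clique [set r] by apply/cliqueP => x y /set1P-> /set1P->; rewrite eqxx.
  have [K mK rK] := maxset_exists cr.
  have Kr : K :&: component r != set0.
    apply/set0Pn; exists r; rewrite inE (subsetP rK) ?set11 //=.
    by rewrite inE connect0.
  by apply: (step K mK Kr) => q s qR sQ qr hs; apply: (key _ K q s _ _ _ _ _ _ (leqnn _)).
elim: n => // n IHn K q s mK /set0Pn[k /setIP[kK kr]] qR sQ qr hs cQ.
have kQ : k \notin cc (far K) q.
  by apply: contraL kK => /(subsetP (cc_subset qR)); apply: far_notin.
have /set0Pn[a aB] := boundary_nonempty (component_connect qr kr) (cc_refl _ q) kQ.
have [z zdom] := boundary_dominator mK qR sQ hs aB.
have [K' [mK' zK' aK']] := max_clique_extend (zdom a aB).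
have ar : a \in component r.
  have /boundaryP[_ [b bQ ab]] := aB; rewrite inE; move: qr; rewrite inE.
  move=> /connect_trans; apply; apply: connect_trans (cc_connect bQ) _.
  by apply: connect1; rewrite adj_sym.
have K'r : K' :&: component r != set0 by apply/set0Pn; exists a; rewrite inE aK'.
apply: (step K' mK' K'r) => q' s' q'R s'Q q'r hs'.
have aQ' : a \notin cc (far K') q'.
  by apply: contraL aK' => /(subsetP (cc_subset q'R)); apply: far_notin.
have B' := boundary_nonempty (component_connect q'r ar) (cc_refl _ q') aQ'.
have lt := far_component_smaller mK qR sQ hs mK' q'R s'Q hs' zK' zdom aK' aB B'.
by apply: (IHn K' q' s') => //; apply: leq_trans lt cQ.
Qed.

(** * The colouring *)

(** By [near_adj], a neighbour in [K] of the first vertex of an induced P4 of the hole sees the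
    whole P4, which gives a gem. *)
Lemma near_hole_free K : max_clique K -> hole_free (near K).
Proof.
move=> mK s sN; apply/negP => hs.
have [c1 [c2 [c3 [c4 [cs p]]]]] : exists c1 c2 c3 c4,
    {subset [:: c1; c2; c3; c4] <= s} /\ ipath [:: c1; c2; c3; c4].
  case: s hs {sN} => [|c1 [|c2 [|c3 [|c4 [|c5 [|c6 [|c7 t]]]]]]] //=;
  rewrite /hole5 /hole6 => h; exists c1, c2, c3, c4; split; try adj_auto;
  by move=> c; rewrite !inE => /or4P[]->; rewrite ?orbT.
have cN : {subset [:: c1; c2; c3; c4] <= near K} by move=> c /cs/sN.
have [N1 N2 N3 N4] : [/\ c1 \in near K, c2 \in near K, c3 \in near K & c4 \in near K].
  by split; apply: cN; rewrite !inE eqxx ?orbT.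
have [x [_ [xK _ x1 _ _]]] := near_stem mK N1.
move: (p); rewrite !ipath_cons /= => h; split_andb.
have x2 : x -- c2 by apply: (near_adj mK N1).
have x3 : x -- c3 by apply: (near_adj mK N2).
have x4 : x -- c4 by apply: (near_adj mK N3).
exact: no_gem x1 x2 x3 x4 p.
Qed.

(** By [near_adj], a vertex of [K] adjacent to one vertex of [A] extends the whole clique. *)
Lemma near_clique K A : max_clique K -> A \subset near K -> clique A ->
  #|A| <= (omega G).-1.
Proof.
move=> mK /subsetP AN /cliqueP cA; have [->|/set0Pn[u uA]] := eqVneq A set0.
  by rewrite cards0.
have [x [_ [xK _ xu _ _]]] := near_stem mK (AN u uA).
have xA y : y \in A -> x -- y.
  move=> yA; have [<-//|uy] := eqVneq u y.
  by apply: (near_adj mK (AN u uA) (AN y yA) _ xK xu); apply: cA.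
have x_notin : x \notin A by apply/negP => /xA; rewrite adj_irr.
have cxA : clique (x |: A).
  apply/cliqueP => y z; rewrite !inE => /predU1P[->|yA] /predU1P[->|zA].
  - by rewrite eqxx.
  - by rewrite xA.
  - by rewrite adj_sym xA.
  - exact: cA.
have : #|x |: A| <= omega G by exact: leq_bigmax_cond.
by rewrite cardsU1 x_notin; case: (omega G).
Qed.

(** No edge joins [K] to [far K], so a hole lies on one side; it is not in [K], where [c1] and [c3]
    would be adjacent. *)
Lemma clique_far_hole_free K A : max_clique K -> hole_free (far K :&: A) ->
  hole_free ((K :|: far K) :&: A).
Proof.
move=> mK fA s sKA; apply/negP => hs.
have sA c : c \in s -> c \in A by move/sKA/setIP => [].
have KF c : c \in s -> c \in K :|: far K by move/sKA/setIP => [].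
have farS c d : c -- d -> c \in far K -> d \in K :|: far K -> d \in far K.
  move=> cd cF /setUP[dK|//].
  by have := far_anti dK cF; rewrite adj_sym cd.
have KS c d : c -- d -> c \in K -> d \in K :|: far K -> d \in K.
  by move=> cd cK /setUP[//|dF]; have := far_anti cK dF; rewrite cd.
suff sF : {subset s <= far K}.
  by have /negP[] := fA s (fun c cs => introT setIP (conj (sF c cs) (sA c cs))).
apply/allP; move/allP: KF; case: s hs {sKA sA} => [|c1 [|c2 [|c3 [|c4 [|c5 [|c6 [|c7 t]]]]]]] //=;
rewrite /hole5 /hole6 => h KF; split_andb.
all: have [c1K|c1F] : c1 \in K \/ c1 \in far K by apply/setUP.
1,3: have c2K : c2 \in K by apply: (KS c1).
1,2: have c3K : c3 \in K by apply: (KS c2).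
1,2: have c13 : c1 != c3 by adj_neq.
1,2: by have ? := max_clique_clique mK c1K c3K c13; adj_contra.
all: have c2F : c2 \in far K by apply: (farS c1).
all: have c3F : c3 \in far K by apply: (farS c2).
all: have c4F : c4 \in far K by apply: (farS c3).
all: have c5F : c5 \in far K by apply: (farS c4).
  by rewrite c1F c2F c3F c4F c5F.
by have c6F : c6 \in far K by [apply: (farS c5)]; rewrite c1F c2F c3F c4F c5F c6F.
Qed.

(** A boolean form, so that a colouring can be obtained by contradiction from [good_clique]. *)
Definition colorableb A k :=
  [exists c : {ffun G -> 'I_k}, [forall x in A, [forall y in A, x -- y ==> (c x != c y)]]].

(** Positivity of [k] provides the default colour that [inord] gives to vertices outside [A]. *)
Lemma colorablebP A k : 0 < k ->
  reflect (exists c : G -> nat, coloring A k c) (colorableb A k).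
Proof.
case: k => // k _; apply: (iffP existsP) => [[c /forall_inP cA]|[c [ck cA]]].
  exists (fun x => c x : nat); split=> [x _|x y xA yA xy]; first exact: ltn_ord.
  by have /forall_inP/(_ y yA)/implyP/(_ xy) := cA x xA.
exists [ffun x => inord (c x)]; apply/forall_inP => x xA; apply/forall_inP => y yA.
apply/implyP => xy; rewrite !ffunE; apply: contra (cA x y xA yA xy) => /eqP/(congr1 val).
by rewrite /= !inordK ?ck // => ->.
Qed.

Lemma component_coloring r :
  exists c : G -> nat, coloring (component r) (2 * omega G - 1) c.
Proof.
have clique_omega A : clique A -> #|A| <= omega G by exact: leq_bigmax_cond.
have w0 : 0 < omega G.
  rewrite -(cards1 r); apply: clique_omega.
  by apply/cliqueP => x y /set1P-> /set1P->; rewrite eqxx.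
have k0 : 0 < 2 * omega G - 1 by case: (omega G) w0 => // w _; rewrite mulnS.
case: (colorablebP (component r) k0) => // ncol; exfalso.
apply: (@good_clique r) => K mK Kr fF; apply: ncol.
have [||c1 [c1k c1A]] := @hole_free_coloring (near K :&: component r) (omega G).-1.
- exact: hole_freeS (subsetIl _ _) (near_hole_free mK).
- by move=> C CN; apply: near_clique mK _; apply: subset_trans CN (subsetIl _ _).
have [||c2 [c2k c2A]] :=
    @hole_free_coloring ((K :|: far K) :&: component r) (omega G).
- exact: clique_far_hole_free.
- by move=> C _; apply: clique_omega.
have split_far x : x \notin near K -> x \in K :|: far K.
  by rewrite in_setU in_setC in_setU; case: (x \in K) => //= ->.
(* The first [(omega G).-1] colours serve [near K]; the shift makes the others disjoint from
   them. *)
exists (fun x => if x \in near K then c1 x else (omega G).-1 + c2 x).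
have eq_k : 2 * omega G - 1 = (omega G).-1 + omega G.
  by case: (omega G) w0 => // w _; rewrite mul2n -addnn /= addSn subn1.
split=> [x xr|x y xr yr xy].
  rewrite eq_k; case: ifPn => [xN|/split_far xF].
    by rewrite ltn_addr // c1k // inE xN.
  by rewrite ltn_add2l c2k // inE xF.
case: ifPn => [xN|/split_far xF]; case: ifPn => [yN|/split_far yF].
- by apply: c1A => //; rewrite in_setI ?xN ?yN.
- by rewrite ltn_eqF // ltn_addr // c1k // inE xN.
- by rewrite gtn_eqF // ltn_addr // c1k // inE yN.
- by rewrite eqn_add2l; apply: c2A => //; rewrite in_setI ?xF ?yF.
Qed.

(** The colourings of the components are glued along canonical roots; adjacent vertices share a root
    and hence a colouring. *)
Lemma colorable_omega : colorable G (2 * omega G - 1).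
Proof.
have [c cP] := fin_all_exists component_coloring.
pose rt x := root (@adj G) x.
have x_rt x : x \in component (rt x).
  by rewrite inE adj_connect_sym connect_root.
have ck x : c (rt x) x < 2 * omega G - 1 by case: (cP (rt x)) => ck _; apply: ck.
apply/existsP; exists [ffun x => Ordinal (ck x)].
apply/forallP => x; apply/forallP => y; apply/implyP => xy; rewrite !ffunE.
have rt_xy : rt x = rt y by apply/(rootP adj_connect_sym)/connect1.
rewrite -val_eqE /= -rt_xy; case: (cP (rt x)) => _; apply=> //.
by rewrite rt_xy.
Qed.

End ForbiddenSubgraphs.

Theorem theorem4p7 (G : sgraph) (nonempty_G : 0 < #|G|)
    (P7_free : free_of (path_graph 7) G)
    (C7_free : free_of (cycle_graph 7) G)
    (C4_free : free_of (cycle_graph 4) G)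
    (gem_free : free_of gem G) :
  chi G <= 2 * omega G - 1.
Proof.
rewrite /chi; case: ex_minnP => k _; apply.
exact: colorable_omega.
Qed.
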